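(* Let $G=\mathbb{Z}^k\oplus F$ with $F$ a finite group, and let $\phi:G\to G$ be an endomorphism with $R(\phi)<\infty$. Then $F$ is exactly the set of torsion elements of $G$, so $\phi(F)\subset F$; let $\phi^{tors}:F\to F$ be the restriction and $\phi^\infty:G/F\to G/F$ the induced endomorphism of $G/F\cong\mathbb{Z}^k$. Let $W$ be the complex vector space of complex-valued class functions on $F$ and $B:W\to W$, $B(h)=h\circ\phi^{tors}$. Let $p$ be the number of eigenvalues $\mu$ of $\phi^\infty$ with $\mu<-1$, and $r$ the number of real eigenvalues of $\phi^\infty$ with $|\mu|>1$. Then $$R(\phi)=(-1)^{r+p}\sum_{i=0}^{k}(-1)^i\,\mathrm{Tr}\big(\Lambda^i\phi^\infty\otimes B\big).$$
   Context: Two elements $\alpha,\alpha'\in G$ are $\phi$-conjugate if $\alpha'=\gamma\alpha\phi(\gamma)^{-1}$ for some $\gamma\in G$; the Reidemeister number $R(\phi)$ is the number of $\phi$-conjugacy classes. $\Lambda^i\phi^\infty$ denotes the $i$-th exterior power of $\phi^\infty\otimes\mathbb{C}$ on $\Lambda^i(\mathbb{C}^k)$. *)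

(* Defs.v *)
From HB Require Import structures.
From mathcomp Require Import all_boot all_order all_algebra all_fingroup all_field.
From mathcomp Require Import mxtens.
Set Implicit Arguments. Unset Strict Implicit. Unset Printing Implicit Defensive.
Import Order.TTheory GRing.Theory Num.Theory.
Local Open Scope ring_scope.

Section GroupZkF.
Variables (k : nat) (gT : finGroupType).
Definition Gty := ('rV[int]_k * gT)%type.
Definition G1 : Gty := (0, 1%g).
Definition Gmul (x y : Gty) : Gty := (x.1 + y.1, (x.2 * y.2)%g).
Definition Ginv (x : Gty) : Gty := (- x.1, (x.2^-1)%g).
Definition Gexp (x : Gty) (n : nat) : Gty := (x.1 *+ n, (x.2 ^+ n)%g).

Definition is_endo (phi : Gty -> Gty) : Prop :=
  forall x y, phi (Gmul x y) = Gmul (phi x) (phi y).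

Definition twconj (phi : Gty -> Gty) (x x' : Gty) : Prop :=
  exists g, x' = Gmul (Gmul g x) (Ginv (phi g)).

Definition reidemeister_number (phi : Gty -> Gty) (n : nat) : Prop :=
  exists s : seq Gty,
    [/\ size s = n,
        (forall x, exists2 y, y \in s & twconj phi y x) &
        (forall a b, (a < n)%N -> (b < n)%N -> a <> b ->
           ~ twconj phi (nth G1 s a) (nth G1 s b))].

Definition phi_tors (phi : Gty -> Gty) (f : gT) : gT := (phi (0, f)).2.

(* phi^infty on G/F = Z^k (row-vector convention: v |-> v *m A) *)
Definition phi_inf_mx (phi : Gty -> Gty) : 'M[int]_k :=
  \matrix_(i, j) (phi (delta_mx 0 i, 1%g)).1 0 j.

Definition phi_inf_C (phi : Gty -> Gty) : 'M[algC]_k :=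
  map_mx intr (phi_inf_mx phi).

(* eigenvalues of phi^infty, with algebraic multiplicity *)
Definition eigs (phi : Gty -> Gty) : seq algC :=
  sval (closed_field_poly_normal (char_poly (phi_inf_C phi))).

Definition p_count (phi : Gty -> Gty) : nat :=
  count (fun mu : algC => mu < -1) (eigs phi).
Definition r_count (phi : Gty -> Gty) : nat :=
  count (fun mu : algC => (mu \is Num.real) && (1 < `|mu|)) (eigs phi).

(* Matrix of B : W -> W, B h = h o phi^tors, in the basis of indicator
   functions of the conjugacy classes of F (column j = coordinates of B(1_{C_j})). *)
Definition nclasses := #|classes [set: gT]|.
Definition Bmx (phi : Gty -> Gty) : 'M[algC]_nclasses :=
  \matrix_(a, b)
    ((phi_tors phi (repr (enum_val (A := classes [set: gT]) a)))
        \in enum_val (A := classes [set: gT]) b)%:R.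
End GroupZkF.

(* i-th exterior power of a k x k matrix, in the basis e_S (S subset of
   {0..k-1} of size i, wedge taken in increasing order): the compound matrix. *)
Section ExtPow.
Variables (R : comRingType) (k : nat).
Definition mxnat (A : 'M[R]_k) (a b : nat) : R :=
  match @insub _ (fun x => (x < k)%N) 'I_k a, @insub _ (fun x => (x < k)%N) 'I_k b with
  | Some a', Some b' => A a' b'
  | _, _ => 0
  end.
Definition ksub (i : nat) := [set S : {set 'I_k} | #|S| == i].
Definition minor_at (A : 'M[R]_k) (i : nat) (S T : {set 'I_k}) : R :=
  \det (\matrix_(a < i, b < i)
          mxnat A (nth 0%N (map val (enum S)) a) (nth 0%N (map val (enum T)) b)).
Definition extpow (i : nat) (A : 'M[R]_k) : 'M[R]_#|ksub i| :=
  \matrix_(P, Q) minor_at A i (enum_val P) (enum_val Q).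
End ExtPow.

(* Main.v *)
Require Import Defs.
From HB Require Import structures.
From mathcomp Require Import all_boot all_order all_algebra all_fingroup all_field.
From mathcomp Require Import mxtens.
Import Order.TTheory GRing.Theory Num.Theory.
Local Open Scope ring_scope.

(** Write [phi (v, f) = (v A, eta v * psi f)].  If [v ~ v + w (1 - A)] has finitely
    many classes then [1 - A] is nonsingular, so fixing the free part forces [w = 0]
    and [R(phi) = |det (1 - A)| * R(psi)].  By Burnside's lemma [R(psi)] is the number
    of conjugacy classes fixed by [psi], that is [tr B].  On the other side,
    [det (1 - A)] is the alternating sum of the [tr (Lambda^i A)], and its sign is the
    parity of the number of eigenvalues [> 1], namely [r - p], because nonreal
    eigenvalues come in conjugate pairs. *)

(** * Traces of exterior powers and the determinant of [1 - A] *)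

Lemma mxtrace_tens (R : pzRingType) (m n : nat) (A : 'M[R]_m) (B : 'M[R]_n) :
  \tr (A *t B) = \tr A * \tr B.
Proof.
by rewrite /mxtrace mulr_sum; apply: eq_bigr => i _; rewrite mxE.
Qed.

(* Sylvester: factor the block matrix [1, X; Y, 1] in two ways. *)
Lemma det1_subC (R : comPzRingType) (m n : nat) (X : 'M[R]_(m, n)) (Y : 'M[R]_(n, m)) :
  \det (1%:M - X *m Y) = \det (1%:M - Y *m X).
Proof.
have e1 : block_mx 1%:M X Y 1%:M *m block_mx 1%:M 0 (- Y) 1%:M
        = block_mx (1%:M - X *m Y) X 0 1%:M.
  rewrite mulmx_block !mulmx1 !mul1mx !mulmx0 !mulmxN ?add0r ?addr0.
  by rewrite subrr.
have e2 : block_mx 1%:M 0 (- Y) 1%:M *m block_mx 1%:M X Y 1%:M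
        = block_mx 1%:M X 0 (1%:M - Y *m X).
  rewrite mulmx_block !mulmx1 !mul1mx !mul0mx !mulNmx ?add0r ?addr0.
  by rewrite addNr addrC.
have := det_mulmx (block_mx 1%:M X Y 1%:M) (block_mx 1%:M 0 (- Y) 1%:M).
by rewrite mulrC -det_mulmx e1 e2 !det_ublock !det1 !mul1r mulr1.
Qed.

(* With [E] the matrix of the inclusion of [S], the minor is [det (E A E^T)] and
   [E E^T = 1]; Sylvester's identity turns it into a determinant of size [k]. *)
Lemma minor_at_restrict (R : comNzRingType) (k i : nat) (A : 'M[R]_k) (S : {set 'I_k}) :
  #|S| = i ->
  minor_at A i S S = \det (\matrix_(a, b) if a \in S then A a b else (a == b)%:R).
Proof.
move=> cS.
have szS : size (map val (enum S)) = i by rewrite size_map -cardE.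
(* All positions read off [enum S] are below [k], so [mxnat] never falls into its default value
   0. *)
have lt_nth (a : 'I_i) : (nth 0%N (map val (enum S)) a < k)%N.
  suff /mapP[x _ ->] : nth 0%N (map val (enum S)) a \in map val (enum S) by apply: ltn_ord.
  by rewrite mem_nth ?szS.
pose g (a : 'I_i) := Ordinal (lt_nth a).
have gS a : g a \in S.
  rewrite -mem_enum -(mem_map val_inj) /= mem_nth ?szS //.
have g_inj : injective g.
  move=> a b /(congr1 val)/= /eqP; rewrite nth_uniq ?szS //.
    by move/eqP/val_inj.
  by rewrite (map_inj_uniq val_inj) enum_uniq.
have gP x : x \in S -> exists a, g a = x.
  rewrite -mem_enum => xS.
  have lt_x : (index (val x) (map val (enum S)) < i)%N.
    by rewrite -szS index_mem map_f.
  by exists (Ordinal lt_x); apply: val_inj; rewrite /= nth_index // map_f.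
pose E : 'M[R]_(i, k) := \matrix_(a, b) (g a == b)%:R.
have EA (n : nat) (B : 'M[R]_(k, n)) : E *m B = \matrix_(a, b) B (g a) b.
  apply/matrixP=> a b; rewrite !mxE (bigD1 (g a)) //= big1 ?mxE ?eqxx ?mul1r ?addr0 //.
  by move=> c /negPf ca; rewrite mxE eq_sym ca mul0r.
have AE (n : nat) (B : 'M[R]_(n, k)) : B *m E^T = \matrix_(a, b) B a (g b).
  apply/matrixP=> a b; rewrite !mxE (bigD1 (g b)) //= big1 ?mxE ?eqxx ?mulr1 ?addr0 //.
  by move=> c /negPf ca; rewrite !mxE eq_sym ca mulr0.
have EE : E *m E^T = 1%:M.
  by apply/matrixP=> a b; rewrite AE !mxE (inj_eq g_inj).
have -> : minor_at A i S S = \det (E *m A *m E^T).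
  congr (\det _); apply/matrixP=> a b; rewrite AE EA !mxE /mxnat.
  by rewrite !(insubT (fun x => (x < k)%N) (lt_nth _)).
have -> : E *m A *m E^T = 1%:M - (E - E *m A) *m E^T.
  by rewrite mulmxBl EE opprB addrC subrK.
rewrite (det1_subC _ _ _ (E - E *m A)) mulmxBr.
(* [E^T *m E] is the diagonal projection onto the coordinates in [S]: the matrix left by Sylvester
   keeps the rows of [A] indexed by [S] and has identity rows elsewhere. *)
have ETE (n : nat) (B : 'M[R]_(k, n)) : E^T *m (E *m B) = \matrix_(a, b) (B a b *+ (a \in S)).
  apply/matrixP=> a b; rewrite EA mxE [RHS]mxE; case: (boolP (a \in S)) => [/gP[c <-]|aS].
    rewrite (bigD1 c) //= big1 ?addr0; first by rewrite !mxE eqxx mul1r.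
    by move=> d dc; rewrite !mxE (inj_eq g_inj) (negPf dc) mul0r.
  rewrite big1 // => c _; rewrite !mxE; case: eqP => [ca|]; last by rewrite mul0r.
  by rewrite -ca gS in aS.
have := ETE _ 1%:M; rewrite mulmx1 ETE => ->; congr (\det _); apply/matrixP=> a b.
rewrite !mxE; case: (a \in S); first by rewrite subKr.
by rewrite !subr0.
Qed.

(** In each Leibniz term, expand the product over the rows of [1 - A]; [S] collects the rows where
    the summand from [- A] is chosen, whence the sign [(-1) ^+ #|S|]. *)
Lemma sum_restrict_det (R : comNzRingType) (k : nat) (A : 'M[R]_k) :
  \det (1%:M - A) = \sum_(S : {set 'I_k})
    (-1) ^+ #|S| * \det (\matrix_(a, b) if a \in S then A a b else (a == b)%:R).
Proof.
transitivity (\sum_(s : 'S_k) \sum_(S : {set 'I_k})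
    (-1) ^+ s * \prod_i (if i \in S then - A i (s i) else (i == s i)%:R)).
  apply: eq_bigr => s _; rewrite -big_distrr /= -bigA_distr /=; congr (_ * _).
  by apply: eq_bigr => i _; rewrite !mxE addrC.
rewrite exchange_big; apply: eq_bigr => S _; rewrite /determinant big_distrr /=.
apply: eq_bigr => s _; rewrite mulrCA; congr (_ * _).
rewrite -prodr_const [X in X * _]big_mkcond /= -big_split; apply: eq_bigr => i _ /=.
by rewrite !mxE; case: ifP => _; rewrite ?mulN1r ?mul1r.
Qed.

(** The diagonal entries of the compound matrix are the principal minors of size [i], so the subset
    expansion of the determinant only has to be grouped by cardinality. *)
Lemma sum_tr_extpow (R : comNzRingType) (k : nat) (A : 'M[R]_k) :
  \sum_(i < k.+1) (-1) ^+ i * \tr (extpow i A) = \det (1%:M - A).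
Proof.
have card_lt (S : {set 'I_k}) : (#|S| < k.+1)%N.
  by rewrite ltnS -[leqRHS](card_ord k) max_card.
rewrite sum_restrict_det (partition_big (fun S => Ordinal (card_lt S)) xpredT) //=.
apply: eq_bigr => i _.
rewrite /mxtrace (eq_bigr (fun P => minor_at A i (enum_val P) (enum_val P))); last first.
  by move=> P _; rewrite mxE.
rewrite -(big_enum_val (fun S => minor_at A i S S)) big_distrr /=.
apply: eq_big => [S|S]; first by rewrite inE.
by rewrite inE => /eqP cS; rewrite minor_at_restrict // cS.
Qed.

(** * The cokernel of an integer matrix *)

(** By the Smith form [M = L D R] with [L] and [R] unimodular, the row lattice of [M] is that of [D]
    carried by [R]. Representatives are the vectors of a box of residues modulo the diagonal
    entries, multiplied by [R]. *)
Lemma coset_representatives (k : nat) (M : 'M[int]_k) :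
  \det M != 0 ->
  exists s : seq 'rV[int]_k,
    [/\ size s = `|\det M|%N, uniq s,
        (forall v, exists2 u, u \in s & exists w, v = u + w *m M) &
        {in s &, forall u v, (exists w, v = u + w *m M) -> u = v}].
Proof.
move=> detM.
have [L Lu [R Ru [d _ defM]]] := int_Smith_normal_form M.
have absdet1 (A : 'M[int]_k) : A \in unitmx -> `|\det A|%N = 1%N.
  by rewrite unitmxE => /orP[] /eqP ->.
have absM : `|\det M|%N = (\prod_(i < k) `|(d`_i)%R|)%N.
  rewrite defM !det_mulmx !abszM (absdet1 _ Lu) (absdet1 _ Ru) mul1n muln1.
  have -> : \matrix_(i, j) (d`_i *+ (i == j :> nat)) = diag_mx (\row_(i < k) d`_i).
    by apply/matrixP=> i j; rewrite !mxE.
  rewrite det_diag (big_morph absz abszM (erefl : `|1%:Z|%N = 1%N)).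
  by apply: eq_bigr => i _; rewrite mxE.
have dn0 (i : 'I_k) : d`_i != 0.
  have : (\prod_(i < k) `|(d`_i)%R| != 0)%N by rewrite -absM absz_eq0.
  by apply: contraNneq => di0; rewrite (bigD1 i) //= di0 mul0n.
(* A dependent product, since the number of residues varies with the coordinate. *)
pose T := fprod (fun i : 'I_k => 'I_(absz (d`_i)%R) : finType).
pose vec (t : T) : 'rV[int]_k := \row_i (val (t i))%:Z.
(* In the coordinates given by [R], congruence modulo the row lattice of [M] is congruence modulo
   [d_i] in each coordinate; [modR] is the converse. *)
have moveR (u v : 'rV[int]_k) : (exists w, v *m R = u *m R + w *m M) ->
    forall i, (u 0%R i = v 0%R i %[mod (d`_i)%R])%Z.
  case=> w e i; pose w' := w *m L.
  have -> : v = u + w' *m \matrix_(i, j) (d`_i *+ (i == j :> nat)).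
    apply: (can_inj (mulmxK Ru)); rewrite e mulmxDl {1}defM.
    by rewrite /w' -!mulmxA.
  rewrite mxE [X in _ + X]mxE (bigD1 i) //= big1 => [|j ji].
    by rewrite addr0 mxE eqxx mulr1n addrC modzMDl.
  by rewrite mxE val_eqE (negPf ji) mulr0.
have modR (u v : 'rV[int]_k) : (forall i, (u 0%R i = v 0%R i %[mod (d`_i)%R])%Z) ->
    exists w, v *m R = u *m R + w *m M.
  move=> e; pose w' : 'rV_k := \row_i ((v 0 i - u 0 i)%R %/ (d`_i)%R)%Z.
  exists (w' *m invmx L); rewrite {1}defM -!mulmxA mulKmx // mulmxA -mulmxDl.
  congr (_ *m _); apply/rowP => i; rewrite mxE [X in _ + X]mxE (bigD1 i) //= big1 => [|j ji].
    rewrite addr0 [X in X * _]mxE [X in _ * X]mxE eqxx mulr1n divzK.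
      by rewrite addrC subrK.
    by rewrite -eqz_mod_dvd; apply/eqP.
  by rewrite [X in _ * X]mxE val_eqE (negPf ji) mulr0.
have vec_eq t t' : (forall i, (vec t 0%R i = vec t' 0%R i %[mod (d`_i)%R])%Z) -> t = t'.
  move=> e; apply/fprodP => i; apply: val_inj.
  have := e i; rewrite !mxE -!(modz_abs _ d`_i) !modz_nat => -[].
  by rewrite !modn_small.
have vecR_inj : injective (fun t => vec t *m R).
  move=> t t' e; apply: vec_eq; apply: moveR.
  by exists 0; rewrite mul0mx addr0 e.
exists [seq vec t *m R | t <- enum T]; split.
- rewrite size_map -cardE card_fprod absM; apply: eq_bigr => i _.
  by rewrite card_ord.
- by rewrite map_inj_uniq ?enum_uniq.
- move=> v.
  have lt_mod (i : 'I_k) :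
      (`|((v *m invmx R)%R 0%R i %% (d`_i)%R)%Z| < `|(d`_i)%R|)%N.
    by rewrite -ltz_nat !abszE ger0_norm ?modz_ge0 ?ltz_mod.
  pose t : T := [fprod i => Ordinal (lt_mod i)].
  exists (vec t *m R); first by apply/mapP; exists t; rewrite ?mem_enum.
  have [i|w ew] := modR (vec t) (v *m invmx R).
    by rewrite mxE fprodE /= abszE ger0_norm ?modz_ge0 // modz_mod.
  by exists w; rewrite -ew mulmxKV.
- by move=> _ _ /mapP[t _ ->] /mapP[t' _ ->] /moveR/vec_eq ->.
Qed.

(** A nonzero [u] with [M *m u^T = 0] gives a functional [f] that vanishes on the row lattice of
    [M], hence is constant on cosets, and is unbounded on [Z^k]. *)
Lemma singular_infinite_cokernel (k : nat) (M : 'M[int]_k) (s : seq 'rV[int]_k) :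
  \det M = 0 -> exists v, forall u w, u \in s -> v != u + w *m M.
Proof.
move=> detM0; have : \det M^T == 0 by rewrite det_tr detM0.
case/det0P=> u un0 uM.
have Mu : M *m u^T = 0 by apply: trmx_inj; rewrite trmx_mul trmxK uM trmx0.
have [j uj] : exists j, u 0 j != 0.
  by apply/existsP; apply: contraNT un0 => /existsPn u0; apply/eqP/rowP => j;
     rewrite mxE; apply/eqP/negPn.
pose f (v : 'rV[int]_k) := (v *m u^T) 0 0.
(* [b] exceeds [|f x|] for every [x] in [s], and the entry [u 0 j] has absolute value at least 1. *)
pose b := (\sum_(x <- s) `|f x|).+1%N.
exists (b%:Z *: delta_mx 0 j) => x w xs; apply/eqP => /(congr1 f).
rewrite /f mulmxDl -mulmxA Mu mulmx0 addr0 -/(f x) -scalemxAl -rowE !mxE => e.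
have : (`|f x| < absz (b%:Z * u 0 j)%R)%N.
  rewrite abszM absz_nat; apply: (@leq_trans b).
    by rewrite /b ltnS (big_rem x) //= leq_addr.
  by rewrite leq_pmulr // absz_gt0.
by rewrite e ltnn.
Qed.

(** * Twisted conjugacy in a finite group *)

(** Burnside's count: [a] fixes [x] exactly when [psi a = a ^ x]. Such [x] exist only if [psi a] is
    conjugate to [a], and then form a coset of the centralizer of [a]; summed over a class, the
    centralizer orders give the order of the group. *)
Lemma card_twisted_orbits (gT : finGroupType) (psi : gT -> gT)
    (to : {action gT &-> gT}) :
  {morph psi : x y / (x * y)%g} ->
  (forall f g, to f g = g^-1 * f * psi g)%g ->
  #|orbit to [set: gT] @: [set: gT]|
  = #|[set C in classes [set: gT] | psi (repr C) \in C]|.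
Proof.
move=> psiM toE.
have psi1 : psi 1%g = 1%g by apply: (mulgI (psi 1%g)); rewrite -psiM !mulg1.
have psiV x : psi x^-1%g = (psi x)^-1%g.
  by apply: (mulgI (psi x)); rewrite -psiM !mulgV psi1.
have psiJ x y : psi (x ^ y)%g = (psi x ^ psi y)%g by rewrite !psiM psiV.
apply/eqP; rewrite -(eqn_pmul2r (cardG_gt0 [set: gT]%G)); apply/eqP.
rewrite -Frobenius_Cauchy; last by apply/actsP=> a _ x; rewrite !inE.
rewrite (set_partition_big _ (classes_partition [set: gT])) /=.
rewrite -sum_nat_const [RHS](eq_bigl (fun C : {set gT} =>
  (C \in classes [set: gT]) && (psi (repr C) \in C))); last first.
  by move=> C; rewrite inE.
rewrite [RHS]big_mkcondr /=; apply: eq_bigr => C CG.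
have [x0 _ defC] := imsetP CG.
have repC : repr C \in C by exact: mem_repr_classes CG.
have CE a : a \in C -> C = (a ^: [set: gT])%g.
  by rewrite defC => /class_eqP.
transitivity (\sum_(a in C) if psi (repr C) \in C then #|'C[a]%g| else 0)%N.
  apply: eq_bigr => a aC.
  (* As [psi] maps conjugates to conjugates, whether [psi a] stays in [C] does not depend on the
     choice of [a] in [C]. *)
  have -> : (psi (repr C) \in C) = (psi a \in C).
    have /imsetP[y _ ->] : repr C \in (a ^: [set: gT])%g by rewrite -(CE a).
    by rewrite psiJ defC memJ_norm // (subsetP (class_norm _ _)) ?inE.
  case: ifP => [paC|paC].
    have /imsetP[y _ ya] : psi a \in (a ^: [set: gT])%g by rewrite -(CE a).
    (* One solution [y] of [psi a = a ^ y] turns the fixed-point set into the right coset of ['C[a]]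
       through [y]. *)
    rewrite -(card_rcoset 'C[a]%g y); apply: eq_card => x.
    rewrite !inE !sub1set !inE toE ya mem_rcoset cent1E conjgE.
    apply/eqP/eqP => e; first by rewrite -{2}e !mulgA mulgV mul1g mulgK.
    have -> : (a^-1 * x * (y^-1 * (a * y)) = a^-1 * (x * y^-1 * a) * y)%g.
      by rewrite !mulgA.
    by rewrite e mulKg mulgKV.
  apply/eqP; rewrite cards_eq0; apply/eqP/setP=> x; rewrite !inE sub1set !inE.
  apply/negbTE; apply: contraFN paC; rewrite toE => /eqP e.
  rewrite (CE a aC); apply/imsetP; exists x; rewrite ?inE //.
  by apply: (mulgI (a^-1 * x)%g); rewrite e conjgE !mulgA mulgK mulVg mul1g.
case: ifP => _; last by rewrite big1.
have C_gt0 : (0 < #|C|)%N by apply/card_gt0P; exists (repr C).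
rewrite (eq_bigr (fun=> #|[set: gT]| %/ #|C|)%N) => [|a aC].
  rewrite sum_nat_const mulnC divnK // (CE _ repC) -index_cent1.
  by rewrite dvdn_indexg.
have := index_cent1 [set: gT]%G a; rewrite setTI -(CE a aC) => iC.
by rewrite -(Lagrange (subsetT 'C[a]%G)) iC mulnK.
Qed.

(** * The sign of a product over a conjugation-stable spectrum *)

Lemma sign_prod_conj_closed (s : seq algC) :
  perm_eq [seq z^* | z <- s] s ->
  0 <= (-1) ^+ count (fun z : algC => 1 < z) s * \prod_(z <- s) (1 - z).
Proof.
move=> sC.
have real_im z : (z \is Num.real) = ('Im z == 0) by apply/Creal_ImP/eqP.
have prod_real : 0 <= (-1) ^+ count (fun z : algC => 1 < z) s *
    \prod_(z <- s | z \is Num.real) (1 - z).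
  elim: s {sC} => [|z s IH]; first by rewrite big_nil mulr1.
  rewrite big_cons /=; case: (boolP (z \is Num.real)) => zR; last first.
    (* The order on [algC] is partial: being comparable with 1 already forces [z] to be real. *)
    suff -> : (1 < z) = false by [].
    by apply: contraNF zR => /ltW /ger_real ->; rewrite rpred1.
  rewrite exprD mulrACA; apply: mulr_ge0 => //.
  have [z1|z1] := real_leP zR (rpred1 _).
    by rewrite expr0 mul1r subr_ge0.
  by rewrite expr1 mulN1r opprB subr_ge0 ltW.
pose lower := [seq z <- s | 'Im z < 0]; pose upper := [seq z <- s | 0 < 'Im z].
(* Conjugation matches the two half-planes with multiplicity, so the product over [upper] is the
   conjugate of the product over [lower]. *)
have lowC : perm_eq [seq z^* | z <- lower] upper.
  have := perm_filter (fun z => 0 < 'Im z) sC; rewrite filter_map.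
  by rewrite (@eq_filter _ _ (fun z => 'Im z < 0)) // => z /=; rewrite Im_conj oppr_gt0.
rewrite (bigID (fun z => z \is Num.real)) /= mulrA; apply: mulr_ge0 => //.
rewrite (bigID (fun z => 'Im z < 0)) /=.
rewrite (eq_bigl (fun z => 'Im z < 0)); last first.
  by move=> z /=; rewrite real_im andb_idl // => /lt_eqF ->.
rewrite [X in _ * X](eq_bigl (fun z => 0 < 'Im z)); last first.
  by move=> z /=; rewrite real_im -real_leNgt ?Creal_Im ?rpred0 // lt0r.
rewrite -[X in X * _]big_filter -[X in _ * X]big_filter -/lower -/upper.
rewrite -(perm_big _ lowC) big_map /=.
under [X in _ * X]eq_bigr do rewrite -(rmorph1 Num.conj) -rmorphB.
by rewrite -rmorph_prod -normCK exprn_ge0.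
Qed.

(** * Additive maps on [Z^k], counting of classes, and eigenvalues of integer matrices *)

Lemma row_morphE (k : nat) (g : 'rV[int]_k -> 'rV[int]_k) :
  {morph g : x y / x + y} ->
  forall v, g v = v *m \matrix_(i, j) (g (delta_mx 0 i)) 0 j.
Proof.
move=> gD v.
have g0 : g 0 = 0 by apply: (addrI (g 0)); rewrite -gD !addr0.
have gB : zmod_morphism g.
  by move=> x y; apply/(canRL (addrK _)); rewrite -gD subrK.
pose gA : {additive 'rV[int]_k -> 'rV[int]_k} :=
  HB.pack g (GRing.isZmodMorphism.Build _ _ g gB).
rewrite -[g]/(gA : _ -> _) {1}[v]row_sum_delta raddf_sum mulmx_sum_row.
apply: eq_bigr => i _; rewrite -[v 0 i]intz !scaler_int raddfMz; congr (_ *~ _).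
by apply/rowP => j; rewrite !mxE.
Qed.

(** Send each entry of [t] to an entry of [s] covering it; two entries with the same image would be
    related, so this is injective. Applied in both directions, it makes the Reidemeister number
    unique. *)
Lemma separated_le_cover (T : eqType) (e : T -> T -> Prop) (x0 : T) (s t : seq T) :
  (forall x y, e x y -> e y x) ->
  (forall x y z, e x y -> e y z -> e x z) ->
  (forall x, exists2 y, y \in s & e y x) ->
  (forall a b, (a < size t)%N -> (b < size t)%N -> a <> b ->
     ~ e (nth x0 t a) (nth x0 t b)) ->
  (size t <= size s)%N.
Proof.
move=> eS eT cov sep.
have ex_f (a : 'I_(size t)) : exists i : 'I_(size s), e (nth x0 s i) (nth x0 t a).
  have [y ys ey] := cov (nth x0 t a).
  have lt_y : (index y s < size s)%N by rewrite index_mem.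
  by exists (Ordinal lt_y); rewrite /= nth_index.
have [f fP] := fin_all_exists ex_f.
have f_inj : injective f.
  move=> a b fab; apply: val_inj; have [//|/eqP nab] := eqVneq (val a) (val b).
  case: (sep _ _ (ltn_ord a) (ltn_ord b) nab).
  by apply: eT (eS _ _ (fP a)) _; rewrite fab.
by have := leq_card f f_inj; rewrite !card_ord.
Qed.

(** Conjugation fixes the integer coefficients, hence permutes the roots with multiplicity. *)
Lemma char_poly_int_conj (k : nat) (A : 'M[int]_k) (s : seq algC) :
  char_poly (map_mx intr A) = \prod_(z <- s) ('X - z%:P) ->
  perm_eq [seq z^* | z <- s] s.
Proof.
move=> es; apply: prod_XsubC_eq; rewrite big_map -(map_prod_XsubC Num.conj) -es.
rewrite -map_char_poly -map_poly_comp; apply: eq_map_poly => n /=.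
exact: rmorph_int.
Qed.

Lemma horner_char_poly (R : comNzRingType) (k : nat) (A : 'M[R]_k) (x : R) :
  (char_poly A).[x] = \det (x%:M - A).
Proof.
rewrite -[LHS]/(horner_eval x _) -det_map_mx; congr (\det _).
apply/matrixP=> i j; rewrite !mxE -[LHS]/(('X *+ (i == j) - (A i j)%:P).[x]).
by rewrite !(hornerD, hornerN, hornerMn, hornerX, hornerC).
Qed.

Lemma row_mulrn_eq0 (k m : nat) (v : 'rV[int]_k) : (0 < m)%N -> v *+ m = 0 -> v = 0.
Proof.
move=> m_gt0 /rowP e; apply/rowP => i; have /eqP := e i.
by rewrite mulmxnE mxE mulrn_eq0 eqn0Ngt m_gt0 => /eqP.
Qed.

(** Real [mu] with [|mu| > 1] are those above 1 and those below -1. The second kind is thus counted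
    twice in [r + p], which has the parity of the number of eigenvalues above 1. *)
Lemma count_real_gt1 (s : seq algC) :
  (count (fun mu : algC => (mu \is Num.real) && (1 < `|mu|)%R) s +
   count (fun mu : algC => mu < -1)%R s =
   count (fun mu : algC => 1 < mu)%R s + (count (fun mu : algC => mu < -1)%R s).*2)%N.
Proof.
elim: s => //= z s IH; rewrite addnACA IH doubleD [RHS]addnACA; congr (_ + _)%N.
case: (boolP (z \is Num.real)) => zR; last first.
  have -> : (1 < z) = false by apply: contraNF zR => /ltW/ger_real ->; rewrite rpred1.
  by have -> : (z < -1) = false by apply: contraNF zR => /ltW/ger_real <-; rewrite rpredN1.
rewrite /= real_ltr_normr // ltrNr; case: (boolP (1 < z)) => z1 /=.
  by rewrite lt_gtF //; apply: lt_trans z1; rewrite (lt_trans (ltrN10 _)) ?ltr01.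
by case: (z < -1).
Qed.

(** * Twisted conjugacy for an endomorphism of [Z^k x F] *)

Section Endomorphism.
Variables (k : nat) (gT : finGroupType) (phi : Gty k gT -> Gty k gT).
Hypothesis phiM : is_endo phi.
Let A := phi_inf_mx phi.
Let psi := phi_tors phi.
Let eta (v : 'rV[int]_k) := (phi (v, 1%g)).2.

Lemma endo1 : phi (G1 k gT) = G1 k gT.
Proof.
have := phiM (G1 k gT) (G1 k gT).
have -> : Gmul (G1 k gT) (G1 k gT) = G1 k gT by rewrite /Gmul addr0 mulg1.
case: (phi _) => a f [ea ef]; congr (_, _).
  by apply: (addrI a); rewrite -ea addr0.
by apply: (mulgI f); rewrite -ef mulg1.
Qed.

(** The element [f] has finite order, while [Z^k] is torsion-free. *)
Lemma endo_torsion (f : gT) : (phi (0, f)).1 = 0.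
Proof.
have expE n : (phi (0, f ^+ n)%g).1 = (phi (0, f)).1 *+ n.
  elim: n => [|n IH]; first by rewrite expg0 endo1.
  by rewrite expgS mulrS -IH -[(0, _)]/(0, _) -[RHS]/((Gmul _ _).1) -phiM /Gmul addr0.
apply: row_mulrn_eq0 (order_gt0 f) _.
by rewrite -expE expg_order -[(0, _)]/(G1 k gT) endo1.
Qed.

Lemma phi_torsM : {morph psi : x y / (x * y)%g}.
Proof.
by move=> x y; have /(congr1 snd) := phiM (0, x) (0, y); rewrite /Gmul /= addr0.
Qed.

Lemma endoE (v : 'rV[int]_k) (f : gT) : phi (v, f) = (v *m A, (eta v * psi f)%g).
Proof.
have -> : (v, f) = Gmul (v, 1%g) (0, f) by rewrite /Gmul /= addr0 mul1g.
rewrite phiM /Gmul endo_torsion addr0; congr (_, _).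
apply: (row_morphE _ (fun v => (phi (v, 1%g)).1)) => x y.
by have /(congr1 fst) := phiM (x, 1%g) (y, 1%g); rewrite /Gmul /= mulg1.
Qed.

Lemma twconjP (x x' : Gty k gT) :
  twconj phi x x' <->
  exists w h, x'.1 = x.1 + w *m (1%:M - A) /\ x'.2 = (h * x.2 * (eta w * psi h)^-1)%g.
Proof.
have wE (w v : 'rV[int]_k) : w + v - w *m A = v + w *m (1%:M - A).
  by rewrite mulmxBr mulmx1 addrA [v + w]addrC.
split=> [[[w h] ->]|[w [h [e1 e2]]]].
  by exists w, h; rewrite endoE /= wE.
by exists (w, h); rewrite endoE /Gmul /Ginv /= wE -e1 -e2 -surjective_pairing.
Qed.

Lemma twconj_sym x y : twconj phi x y -> twconj phi y x.
Proof.
case=> g ->; exists (Ginv g).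
have /esym := phiM (Ginv g) g.
have -> : Gmul (Ginv g) g = G1 k gT by rewrite /Gmul addNr mulVg.
rewrite endo1; case: (phi (Ginv g)) => a f; case: (phi g) => b h [/eqP].
rewrite addr_eq0 => /eqP -> /eqP; rewrite -eq_invg_mul => /eqP <-.
case: x g => [x1 x2] [g1 g2]; rewrite /Gmul /Ginv /=.
congr (_, _); first by rewrite opprK -[g1 + x1 - b]addrA addKr subrK.
by rewrite invgK !mulgA mulVg mul1g mulgK.
Qed.

Lemma twconj_trans x y z :
  twconj phi x y -> twconj phi y z -> twconj phi x z.
Proof.
case=> g -> [h ->]; exists (Gmul h g); rewrite phiM /Gmul /Ginv /=.
congr (_, _); first by rewrite opprD !addrA [LHS]addrAC.
by rewrite invMg !mulgA.
Qed.

Lemma reidemeister_number_uniq n m :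
  reidemeister_number phi n -> reidemeister_number phi m -> n = m.
Proof.
move=> [s [<- sc sd]] [t [<- tc td]]; apply/eqP; rewrite eqn_leq; apply/andP; split.
  exact: separated_le_cover twconj_sym twconj_trans tc sd.
exact: separated_le_cover twconj_sym twconj_trans sc td.
Qed.

(** The free parts of the representatives meet every coset of the row lattice of [1 - A], which a
    finite list cannot do when the determinant vanishes. *)
Lemma reidemeister_finite_det n : reidemeister_number phi n -> \det (1%:M - A) != 0.
Proof.
move=> [s [_ cov _]]; apply/eqP => det0.
have [v vP] := singular_infinite_cokernel _ _ [seq x.1 | x <- s] det0.
have [y ys /twconjP[w [h [/= e _]]]] := cov (v, 1%g).
by have /eqP := vP y.1 w (map_f _ ys).
Qed.

(** Representatives are the pairs of a coset representative for [1 - A] and an orbit representative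
    for [psi]-twisted conjugacy on [F]. *)
Lemma reidemeister_count : \det (1%:M - A) != 0 ->
  reidemeister_number phi
    (`|\det (1%:M - A)| * #|[set C in classes [set: gT] | psi (repr C) \in C]|)%N.
Proof.
move=> detA.
have psi1 : psi 1%g = 1%g by rewrite /psi /phi_tors -[(0, _)]/(G1 k gT) endo1.
have psiV x : psi x^-1%g = (psi x)^-1%g.
  by apply: (mulgI (psi x)); rewrite -phi_torsM !mulgV psi1.
pose tw (f g : gT) := (g^-1 * f * psi g)%g.
have tw1 f : tw f 1%g = f by rewrite /tw psi1 invg1 mul1g mulg1.
have twM f : act_morph tw f by move=> a b; rewrite /tw phi_torsM invMg !mulgA.
pose to := TotalAction tw1 twM.
rewrite -(card_twisted_orbits _ _ to phi_torsM) //.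
have acts_to : [acts [set: gT], on [set: gT] | to] by apply/actsP=> a _ x; rewrite !inE.
have [trX _ Xuniq Xcov] := orbit_transversalP acts_to.
set X := orbit_transversal _ _ _ in trX Xuniq Xcov.
have [s [<- s_uniq s_cov s_sep]] := coset_representatives _ _ detA.
rewrite -(card_transversal trX) cardE -(size_allpairs pair).
set t := [seq (u, f) | u <- s, f <- enum X].
have t_uniq : uniq t.
  by apply: allpairs_uniq => //; [exact: enum_uniq | case=> u f [u' f'] _ _ [-> ->]].
exists t; split=> // [[v f]|a b lt_a lt_b nab tw_ab].
  have [u us [w ew]] := s_cov v.
  (* Moving the free part by [w] multiplies the torsion part by an inverse of [eta w]; picking the
     orbit of [f * eta w] compensates for it. *)
  have [a _ aX] := Xcov (f * eta w)%g (in_setT _).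
  exists (u, to (f * eta w)%g a); first by apply: allpairs_f; rewrite ?mem_enum.
  apply/twconjP; exists w, a; split=> //=.
  by rewrite /tw invMg !mulgA mulgV mul1g !mulgK.
have := mem_nth (G1 k gT) lt_a; have := mem_nth (G1 k gT) lt_b.
case/allpairsP=> -[u' f'] [/= us' fX' eb] /allpairsP[[u f] [/= us fX ea]].
case: nab; apply/eqP; rewrite -(nth_uniq (G1 k gT) lt_a lt_b t_uniq).
move: tw_ab; rewrite ea eb => /twconjP[w [h [/= eu ef]]].
have uu' : u = u' by apply: s_sep => //; exists w.
(* Nonsingularity kills [w], so [eta w] is trivial and what remains is [psi]-twisted conjugacy by
   [h]. *)
have w0 : w = 0.
  apply/eqP; apply: contraNT detA => wn0; apply/det0P; exists w => //.
  by apply: (addrI u); rewrite -eu addr0 uu'.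
suff -> : f = f' by rewrite uu'.
rewrite !mem_enum in fX fX'.
(* The action [to] puts the inverse on the left, hence the witness [h^-1]. *)
apply/eqP; rewrite -(Xuniq _ _ fX fX'); apply/imsetP; exists h^-1%g; rewrite ?inE //=.
by rewrite /tw invgK ef w0 /eta -[(0, _)]/(G1 k gT) endo1 mul1g psiV.
Qed.

Lemma tr_Bmx : \tr (Bmx phi) =
  #|[set C in classes [set: gT] | psi (repr C) \in C]|%:R.
Proof.
rewrite /mxtrace (eq_bigr (fun a => (psi (repr (enum_val a)) \in enum_val a)%:R)) => [|a _].
  rewrite -(big_enum_val (fun C : {set gT} => (psi (repr C) \in C)%:R)).
  rewrite -sum1_card natr_sum big_mkcond [RHS]big_mkcond; apply: eq_bigr => C _.
  by rewrite inE; case: (C \in _); case: (_ \in C).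
by rewrite mxE.
Qed.

Lemma sign_det : ((-1) ^+ (r_count phi + p_count phi) *
  \det (1%:M - phi_inf_C phi) : algC) = `|\det (1%:M - A)|%N%:R.
Proof.
rewrite /r_count /p_count /eigs; case: closed_field_poly_normal => s /= es.
rewrite (monicP (char_poly_monic _)) scale1r in es.
rewrite count_real_gt1 exprD -muln2 exprM sqrr_sign mulr1.
have detE : \det (1%:M - phi_inf_C phi) = \prod_(z <- s) (1 - z).
  (* The determinant is the characteristic polynomial evaluated at 1. *)
  rewrite -horner_char_poly es horner_prod; apply: eq_bigr => z _.
  by rewrite !hornerE.
(* The signed determinant is nonnegative, so it equals its own norm, from which the sign drops
   out. *)
have := sign_prod_conj_closed s (char_poly_int_conj _ _ _ es).
rewrite -detE => /ger0_norm <-; rewrite normrMsign.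
have -> : 1%:M - phi_inf_C phi = map_mx intr (1%:M - A).
  by rewrite map_mxB map_mx1.
by rewrite det_map_mx /= -intr_norm.
Qed.
End Endomorphism.

Theorem theorem5 (k : nat) (gT : finGroupType) (phi : Gty k gT -> Gty k gT) :
  is_endo phi ->
  (exists n, reidemeister_number phi n) ->
  [/\ (forall x : Gty k gT,
         (exists2 m, (0 < m)%N & Gexp x m = G1 k gT) <-> x.1 = 0),
      (forall f : gT, (phi (0, f)).1 = 0) &
      (forall n, reidemeister_number phi n ->
         (n%:R : algC) =
         (-1) ^+ (r_count phi + p_count phi) *
         \sum_(i < k.+1)
            (-1) ^+ i * \tr (extpow i (phi_inf_C phi) *t Bmx phi))].
Proof.
move=> phiM [n0 Rn0]; have detA := reidemeister_finite_det _ _ _ phiM _ Rn0.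
split=> [x|f|n Rn]; last first.
- rewrite (reidemeister_number_uniq _ _ _ phiM _ _ Rn (reidemeister_count _ _ _ phiM detA)).
  rewrite natrM -sign_det // -tr_Bmx -mulrA; congr (_ * _).
  rewrite -sum_tr_extpow big_distrl /=; apply: eq_bigr => i _.
  by rewrite mxtrace_tens mulrA.
- exact: endo_torsion.
split=> [[m m_gt0 [e _]]|x0]; first exact: row_mulrn_eq0 m_gt0 e.
by exists #[x.2]%g; rewrite ?order_gt0 // /Gexp x0 mul0rn expg_order.
Qed.
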